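(* Let $(\star)$ be a linear system over $\mathbb{F}_q$ with coefficient matrix $A\in\mathbb{F}_q^{m\times k}$ which is of type (RC), non-degenerate and irreducible, and let $\ell$ be its number of column equivalence classes. Suppose that at least one of the following holds: (i) none of the column equivalence classes of size $2$ sums to zero; (ii) every column equivalence class sums to zero, and $k\ge 3$. Then $(\star)$ is moderate.
   Context: Let $\mathbb{F}_q$ be a finite field with $q$ elements. A linear system $(\star)$ with coefficient matrix $A=(a_{ij})\in\mathbb{F}_q^{m\times k}$ is the system of equations $a_{i1}x_1+\cdots+a_{ik}x_k=0$ ($i\in[m]$); a solution is a $k$-tuple $(x_1,\dots,x_k)\in(\mathbb{F}_q^n)^k$ satisfying all of them. The system is balanced if every row of $A$ sums to $0$. A $(\star)$-shape is a solution with $x_1,\dots,x_k$ pairwise distinct. The system is moderate if there exist constants $\beta,\gamma>0$ with $\gamma<q$ such that for every $n$, every subset $S\subseteq\mathbb{F}_q^n$ with $|S|\ge\beta\gamma^n$ contains a $(\star)$-shape, i.e. one with $(x_1,\dots,x_k)\in S^k$. Two indices $j,j'\in[k]$ are equivalent if the $j$-th and $j'$-th columns of $A$ are nonzero scalar multiples of one another; the equivalence classes are the column equivalence classes. A column equivalence class sums to zero if the columns of $A$ indexed by it add up to the zero vector. The system is of type (RC) if it is balanced and has at most one column equivalence class of size $1$. It is non-degenerate if the rows of $A$ are linearly independent and every variable is used (no column of $A$ is zero). Two systems are equivalent if each equation of one is a linear combination of the equations of the other. A system is reducible if it is equivalent to a system whose variables $x_1,\dots,x_k$ can be partitioned into two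 or more classes such that every equation only uses (has nonzero coefficients on) variables from one class; otherwise it is irreducible. *)

(* Defs.v *)
From HB Require Import structures.
From mathcomp Require Import all_boot all_order all_algebra all_field.
From mathcomp Require Import reals.
Set Implicit Arguments. Unset Strict Implicit. Unset Printing Implicit Defensive.
Import Order.TTheory GRing.Theory Num.Theory.
Local Open Scope ring_scope.

Section LinSys.
Variables (F : finFieldType) (m k : nat) (A : 'M[F]_(m, k)).

Definition is_solution (n : nat) (x : 'I_k -> 'rV[F]_n) : Prop :=
  forall i : 'I_m, \sum_(j < k) A i j *: x j = 0.

Definition is_shape (n : nat) (x : 'I_k -> 'rV[F]_n) : Prop :=
  is_solution x /\ injective x.

Definition balanced : Prop := forall i : 'I_m, \sum_(j < k) A i j = 0.

Definition col_equiv (j j' : 'I_k) : bool :=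
  [exists c : F, (c != 0) && (col j A == c *: col j' A)].

Definition col_class (j : 'I_k) : {set 'I_k} := [set j' | col_equiv j j'].

Definition col_classes : {set {set 'I_k}} := [set col_class j | j : 'I_k].

Definition class_sums_to_zero (C : {set 'I_k}) : bool :=
  \sum_(j in C) col j A == 0.

Definition typeRC : Prop :=
  balanced /\ (#|[set C in col_classes | #|C| == 1%N]| <= 1)%N.

Definition non_degenerate : Prop :=
  row_free A /\ forall j : 'I_k, col j A != 0.

Definition reducible : Prop :=
  exists (m' : nat) (B : 'M[F]_(m', k)),
    (A == B)%MS /\
    exists P : {set {set 'I_k}},
      partition P [set: 'I_k] /\ (2 <= #|P|)%N /\
      forall i : 'I_m', exists2 C, C \in P & forall j, B i j != 0 -> j \in C.

Definition irreducible : Prop := ~ reducible.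

Definition moderate (R : realType) : Prop :=
  exists beta gamma : R,
    [/\ 0 < beta, 0 < gamma, gamma < (#|F|)%:R &
      forall (n : nat) (S : {set 'rV[F]_n}),
        beta * gamma ^+ n <= (#|S|)%:R ->
        exists x : 'I_k -> 'rV[F]_n, is_shape x /\ forall j, x j \in S].

End LinSys.

(* Main.v *)
Require Import Defs.
From HB Require Import structures.
From mathcomp Require Import all_boot all_order all_algebra all_field.
From mathcomp Require Import reals zify ring lra.
Import Order.TTheory GRing.Theory Num.Theory.
Local Open Scope ring_scope.
Set Implicit Arguments. Unset Strict Implicit. Unset Printing Implicit Defensive.

(** Two coordinates [x i], [x l] in one column class can be replaced by any
    [u], [u'] with [a u + b u' = a x i + b x l]. A dense [S] has a dense subset
    [S'] in which all such sums (except those with [x i = x l] and [a + b = 0])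
    have many representations over [S]: a maximal independent set in the sparse
    graph of pairs with few representations, after discarding the points [x] for
    which [(a + b) x] has few, whose number is bounded by the cap set theorem for
    [a x + b y = (a + b) z]. Hence, along a chain of dense subsets, coincidences
    of a solution can be removed one at a time, as long as no class made of two
    opposite columns takes equal values at the start.

    In case (i) there is no such class, and a constant solution will do. In case
    (ii) each class [C] contributes one difference [y_C] of elements of [S], and
    the [y_C] must solve the system and be nonzero for [#|C| = 2]. By
    irreducibility, each coordinate is nonzero on some kernel vector [w];
    Cauchy-Schwarz gives many [a <> 0] with every [w_C a] a popular difference
    of given dense sets, and iterating over all kernel vectors, with
    [y := y + w a], makes the [y_C] nonzero. *)

(** * Independent sets in sparse graphs *)

(** Turán-type argument: dropping the vertices of high degree leaves at least half of [V], and the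
    closed neighbourhoods of a maximal independent set cover what is left. *)
Lemma sparse_indep (T : finType) (e : rel T) (V : {set T}) :
  exists I : {set T}, [/\ I \subset V,
    {in I &, forall x y, x != y -> ~~ e x y} &
    (#|V| ^ 2 <= 2 * #|I| * (#|V| + 4 * \sum_(x in V) #|[set y in V | e x y]|))%N].
Proof.
set E := (\sum_(x in V) _)%N.
pose nb x := [set y in V | e x y] :|: [set y in V | e y x].
have degE : (\sum_(x in V) #|nb x| <= 2 * E)%N.
  rewrite mul2n -addnn {2}/E.
  have -> : (\sum_(x in V) #|[set y in V | e x y]| = \sum_(x in V) #|[set y in V | e y x]|)%N.
    under eq_bigr => x _ do rewrite -sum1dep_card big_mkcondr.
    rewrite exchange_big /=; apply: eq_bigr => y yV.
    by rewrite -sum1dep_card big_mkcondr.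
  by rewrite -big_split leq_sum // => x _; rewrite cardsU leq_subr.
(* The mean degree is at most [2 * E / #|V|]; by Markov's inequality at least half of the vertices
   have at most twice that. *)
pose V' := [set x in V | (#|nb x| * #|V| <= 4 * E)%N].
have V'V : V' \subset V by apply/subsetP => x; rewrite inE => /andP[].
have cardV' : (#|V| <= 2 * #|V'|)%N.
  have -> : V' = V :\: [set x in V | (4 * E < #|nb x| * #|V|)%N].
    by apply/setP => x; rewrite !inE; case: (x \in V) => //=; rewrite andbT -leqNgt.
  set B := [set x in V | _].
  have BV : B \subset V by apply/subsetP => x; rewrite inE => /andP[].
  rewrite cardsD (setIidPr BV).
  suff : (2 * #|B| <= #|V|)%N by move=> h; rewrite mulnBr; lia.
  have h1 : (#|B| * (4 * E).+1 <= 2 * E * #|V|)%N.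
    rewrite -sum_nat_const (leq_trans _ (leq_mul degE (leqnn #|V|))) // big_distrl /=.
    rewrite [X in (_ <= X)%N](bigID (mem B)) /= -[X in (X <= _)%N]addn0 leq_add //.
    rewrite [X in (_ <= X)%N](eq_bigl (mem B)); last first.
      by move=> x /=; rewrite andbC; case: (boolP (x \in B)) => //= /(subsetP BV).
    by apply: leq_sum => x; rewrite inE => /andP[].
  have [->|B0] := posnP #|B|; first by rewrite muln0.
  have E0 : (0 < E)%N by case: posnP h1 => // ->; rewrite !muln0 mul0n; lia.
  nia.
have [I /maxsetP[/andP[IV' Iind] Imax]] :=
  ex_maxset (ex_intro (fun I : {set T} => (I \subset V') &&
    [forall x in I, forall y in I, (x != y) ==> ~~ e x y]) set0
    (introT andP (conj (sub0set V') (introT forall_inP (fun x (h : x \in set0) =>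
       ltac:(by rewrite inE in h)))))).
have Ind : {in I &, forall x y, x != y -> ~~ e x y}.
  by move=> x y xI yI /(implyP (forall_inP (forall_inP Iind _ xI) _ yI)).
exists I; split=> //; first exact: subset_trans V'V.
have cov : V' \subset \bigcup_(x in I) (x |: nb x).
  apply/subsetP => v vV'; apply: contraT => vN.
  have vnI x : x \in I -> v \notin x |: nb x.
    by move=> xI; apply: contra vN => h; apply/bigcupP; exists x.
  have vI : v \notin I by apply/negP => h; have := vnI _ h; rewrite setU11.
  have vP : (v |: I \subset V') && [forall x in v |: I, forall y in v |: I, (x != y) ==> ~~ e x y].
    apply/andP; split; first by rewrite subUset sub1set vV'.
    have vV := subsetP V'V _ vV'.
    apply/forall_inP => x; rewrite in_setU1 => xI.
    apply/forall_inP => y; rewrite in_setU1 => yI; apply/implyP => xy.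
    case/orP: xI yI => [/eqP xv|xI] /orP[/eqP yv|yI]; last exact: Ind.
    - by rewrite xv yv eqxx in xy.
    - have := vnI _ yI; rewrite !inE vV xv /= -xv => /norP[_].
      by rewrite negb_or => /andP[].
    - by have := vnI _ xI; rewrite !inE vV yv /= -yv => /norP[_]; rewrite negb_or => /andP[].
  by have := setU11 v I; rewrite (Imax _ vP (subsetUr _ _)) (negPf vI).
have : (#|V'| * #|V| <= #|I| * (#|V| + 4 * E))%N.
  apply: leq_trans (leq_mul (subset_leq_card cov) (leqnn _)) _.
  apply: (@leq_trans ((\sum_(x in I) #|x |: nb x|) * #|V|)%N).
    rewrite leq_mul2r; apply/orP; right.
    elim/big_rec2: _ => [|x n A _ h]; first by rewrite cards0.
    by rewrite (leq_trans (leq_card_setU _ _)) // leq_add2l.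
  rewrite big_distrl -sum_nat_const leq_sum //= => x xI.
  have := subsetP IV' _ xI; rewrite inE => /andP[_ h].
  rewrite cardsU1 mulnDl leq_add //.
  by case: (x \notin _); rewrite ?mul1n ?mul0n.
nia.
Qed.

(** * Slice rank and the cap set bound for three-term equations *)

(** The left kernel has dimension at least [N - M]. An invertible maximal minor of a basis allows
    prescribing a kernel vector on that many coordinates. *)
Lemma large_support_annihilator (F : fieldType) (N M : nat) (f : 'M[F]_(N, M)) :
  exists (d : nat) (J : 'I_d -> 'I_N) (h : 'rV[F]_N),
    [/\ (N <= d + M)%N, injective J, h *m f = 0 & forall t, h 0 (J t) = 1].
Proof.
pose K := row_base (kermx f).
have Kfull : row_full K^T by rewrite /row_full mxrank_tr; apply: row_base_free.
pose J := fullrankfun Kfull; have Ju := fullrowsub_unit Kfull.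
pose B := colsub J K.
have Bu : B \in unitmx.
  by rewrite -unitmx_tr; move: Ju; congr (_ \in unitmx); apply/matrixP => i j; rewrite !mxE.
exists (\rank (kermx f)), J, (const_mx 1 *m invmx B *m K); split.
- by rewrite mxrank_ker addnC -leq_subLR leq_sub2l // rank_leq_col.
- exact: fullrankfun_inj.
- have Kf : K *m f = 0 by apply/sub_kermxP; rewrite eq_row_base.
  by rewrite -[LHS]mulmxA Kf mulmx0.
- move=> t; transitivity (((const_mx 1 : 'rV_(\rank (kermx f))) *m invmx B *m B) 0 t).
    by rewrite !mxE; apply: eq_bigr => i _; rewrite [B i t]mxE.
  by rewrite mulmxKV // mxE.
Qed.

(* Tao's slice rank lemma: contracting [z] against some [h] annihilating the
   third sum leaves a diagonal matrix of rank at least [#|A| - #|B|]. *)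
Lemma diagonal_slice_rank (F : fieldType) (T L : finType) (A : {set T}) (B : {set L})
    (f : T -> L -> F) (g1 g2 g3 : L -> T -> T -> F) :
  {in A & A & A, forall x y z, ((x == y) && (y == z))%:R =
     \sum_(i in B) f x i * g1 i y z + \sum_(i in B) f y i * g2 i x z
     + \sum_(i in B) f z i * g3 i x y} ->
  (#|A| <= 3 * #|B|)%N.
Proof.
move=> diagE.
pose v (i : 'I_#|A|) : T := enum_val i.
pose w (i : 'I_#|B|) : L := enum_val i.
have sumB G : \sum_(i in B) G i = \sum_i G (w i) :> F by apply: big_enum_val.
have vA i : v i \in A by apply: enum_valP.
have [d [J [h [dN Jinj hf hJ]]]] := large_support_annihilator (\matrix_(z, i) f (v z) (w i)).
have hf0 i : \sum_z h 0 z * f (v z) (w i) = 0.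
  move/rowP/(_ i): hf; rewrite !mxE => hfi; rewrite -[RHS]hfi.
  by apply: eq_bigr => z _; rewrite mxE.
pose P := \matrix_(s < d, i < #|B|) f (v (J s)) (w i).
pose Q1 := \matrix_(i < #|B|, t < d) \sum_z h 0 z * g1 (w i) (v (J t)) (v z).
pose Q2 := \matrix_(i < #|B|, s < d) \sum_z h 0 z * g2 (w i) (v (J s)) (v z).
have decomp : 1%:M = P *m Q1 + (P *m Q2)^T.
  apply/matrixP => s t.
  transitivity (\sum_z h 0 z * ((v (J s) == v (J t)) && (v (J t) == v z))%:R).
    rewrite (bigD1 (J t)) //= eqxx andbT hJ mul1r big1 ?addr0; last first.
      move=> z zJ; rewrite (inj_eq enum_val_inj (J t)) [J t == z]eq_sym (negPf zJ) andbF mulr0 //.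
    by rewrite !mxE (inj_eq enum_val_inj) (inj_eq Jinj).
  under eq_bigr => z _ do rewrite (diagE _ _ _ (vA _) (vA _) (vA _)) !sumB !mulrDr.
  rewrite !big_split /= [X in _ + X](_ : _ = 0) ?addr0; last first.
    under eq_bigr => z _ do rewrite big_distrr.
    rewrite exchange_big big1 //= => i _.
    under eq_bigr => z _ do rewrite mulrA.
    by rewrite -big_distrl /= hf0 mul0r.
  have pull (g : L -> T -> F) x : \sum_z h 0 z * (\sum_i f x (w i) * g (w i) (v z)) =
      \sum_i f x (w i) * \sum_z h 0 z * g (w i) (v z).
    under eq_bigr => z _ do rewrite big_distrr.
    rewrite exchange_big /=; apply: eq_bigr => i _; rewrite big_distrr /=.
    by apply: eq_bigr => z _; rewrite mulrCA.
  rewrite (pull (fun i z => g1 i _ z)) (pull (fun i z => g2 i _ z)) !mxE.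
  by congr (_ + _); apply: eq_bigr => i _; rewrite !mxE.
(* Both products factor through [#|B|] coordinates, and [#|A| <= d + #|B|]. *)
have : (d <= #|B| + #|B|)%N.
  rewrite -[X in (X <= _)%N](mxrank1 F) decomp.
  apply: leq_trans (mxrank_add _ _) _; rewrite mxrank_tr.
  by rewrite leq_add // (leq_trans (mxrankM_maxl _ _)) // rank_leq_col.
lia.
Qed.

(** As [u ^+ #|F| = u], the indicator of [u = 0] is [1 - u ^+ #|F|.-1]. The power expands into
    monomials of total degree [#|F|.-1]; the index [None] carries the constant 1. *)
Lemma zero_indicator_expansion (F : finFieldType) (a b c : F) :
  exists (T : finType) (e1 e2 e3 : T -> 'I_#|F|) (cf : T -> F),
    (forall t, cf t != 0 -> (e1 t + e2 t + e3 t <= #|F|.-1)%N) /\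
    forall x y z : F, (a * x + b * y + c * z == 0)%:R =
      \sum_t cf t * x ^+ e1 t * y ^+ e2 t * z ^+ e3 t.
Proof.
have q_gt0 : (0 < #|F|)%N by apply/card_gt0P; exists 0.
pose N := #|F|.-1; have qE : #|F| = N.+1 by rewrite prednK.
have lt m : (m <= N)%N -> (m < #|F|)%N by rewrite qE.
exists (option ('I_N.+1 * 'I_N.+1)%type).
exists (fun t : option ('I_N.+1 * 'I_N.+1) => if t is Some p then Ordinal (lt (N - p.1)%N (leq_subr _ _)) else Ordinal q_gt0).
exists (fun t : option ('I_N.+1 * 'I_N.+1) => if t is Some p then Ordinal (lt (p.1 - p.2)%N (leq_trans (leq_subr _ _) (leq_ord p.1))) else Ordinal q_gt0).
exists (fun t : option ('I_N.+1 * 'I_N.+1) => if t is Some p then Ordinal (lt p.2 (leq_ord p.2)) else Ordinal q_gt0).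
(* For [p.2 > p.1] the truncated difference of exponents is harmless: the binomial coefficient
   vanishes. *)
exists (fun t : option ('I_N.+1 * 'I_N.+1) => if t is Some p then
   - (a ^+ (N - p.1) * b ^+ (p.1 - p.2) * c ^+ p.2 *+ ('C(p.1, p.2) * 'C(N, p.1))) else 1).
split.
  case=> [[i j]|] //=; have [ij|ji] := leqP j i; last by rewrite bin_small ?mul0n ?mulr0n ?oppr0 ?eqxx.
  by move=> _; rewrite -addnA subnK // subnK // -ltnS.
move=> x y z; rewrite (bigD1 None) //= !expr0 !mulr1.
rewrite (reindex_omap Some id) /=; last by case.
under [X in 1 + X]eq_bigl => p do rewrite eqxx.
have -> : (a * x + b * y + c * z == 0)%:R = 1 - (a * x + b * y + c * z) ^+ N.
  set u := (_ + _ + _); have [->|u0] := eqVneq u 0.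
    by rewrite expr0n eqn0Ngt -ltnS -qE finNzRing_gt1 subr0.
  by apply/esym/eqP; rewrite subr_eq0 eq_sym -(inj_eq (mulfI u0)) mulr1 -exprS -qE expf_card.
congr (_ + _); rewrite -addrA exprDn.
rewrite -sumrN -(pair_bigA _ (fun i j : 'I_N.+1 => - (a ^+ (N - i) * b ^+ (i - j) * c ^+ j *+ ('C(i, j) * 'C(N, i)))
   * x ^+ (N - i) * y ^+ (i - j) * z ^+ j)) /=.
apply: eq_bigr => i _; rewrite exprDn (big_ord_widen N.+1 (fun j => (b * y) ^+ (i - j) * (c * z) ^+ j *+ 'C(i, j))) ?ltn_ord //.
rewrite big_mkcond /= big_distrr /= -sumrMnl -sumrN; apply: eq_bigr => j _.
case: ltnP => ij; last by rewrite (bin_small ij) !(mulr0n, mulr0, mul0rn, mul0n, oppr0, mul0r).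
rewrite !exprMn mulrnAr -mulrnA !mulNr !mulrnAl; congr (- (_ *+ _)).
by move: (a ^+ _) (b ^+ _) (c ^+ _) (x ^+ _) (y ^+ _) (z ^+ _) => *; ring.
Qed.

(** Exponent vectors of monomials whose degree is at most a third of the maximum [n * q.-1]. *)
Definition low_degree (q n : nat) : {set {ffun 'I_n -> 'I_q}} :=
  [set u : {ffun 'I_n -> 'I_q} | (3 * \sum_s u s <= n * q.-1)%N].

(** Ellenberg-Gijswijt argument: multiplied over the coordinates, the expansions give terms of total
    degree at most [n * #|F|.-1], so one of the three factors has low degree. Grouping by that
    factor gives a slice decomposition of the diagonal. *)
Lemma trivial_solutions_card (F : finFieldType) (n : nat) (a b c : F) (A : {set 'rV[F]_n}) :
  a + b + c = 0 ->
  {in A & A & A, forall x y z, a *: x + b *: y + c *: z = 0 -> x = y /\ y = z} ->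
  (#|A| <= 3 * #|low_degree #|F| n|)%N.
Proof.
move=> abc0 triv.
have [T [e1 [e2 [e3 [cf [cf_deg expand]]]]]] := zero_indicator_expansion a b c.
pose E (e : T -> 'I_#|F|) (p : {ffun 'I_n -> T}) := [ffun s => e (p s)].
pose Mon (u : {ffun 'I_n -> 'I_#|F|}) (x : 'rV[F]_n) := \prod_s x 0 s ^+ u s.
pose Cf (p : {ffun 'I_n -> T}) := \prod_s cf (p s).
pose low := low_degree #|F| n.
pose term p x y z := Cf p * Mon (E e1 p) x * Mon (E e2 p) y * Mon (E e3 p) z.
have deg p : Cf p != 0 -> [|| E e1 p \in low, E e2 p \in low | E e3 p \in low].
  move=> cf0; rewrite -[_ || _]negbK !negb_or !inE -!ltnNge; apply/negP => /and3P[h1 h2 h3].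
  have : (\sum_s E e1 p s + \sum_s E e2 p s + \sum_s E e3 p s <= n * #|F|.-1)%N.
    rewrite -!big_split -[X in (_ <= X * _)%N]card_ord -sum_nat_const; apply: leq_sum => s _.
    by rewrite !ffunE cf_deg //; apply: contraNneq cf0 => h; rewrite /Cf (bigD1 s) //= h mul0r.
  move: h1 h2 h3; move: (n * _)%N (\sum_s E e1 p s)%N (\sum_s E e2 p s)%N (\sum_s E e3 p s)%N => *; lia.
(* Each term is assigned to its first factor of low degree, so none is counted twice. *)
pose P1 := [pred p | E e1 p \in low].
pose P2 := [pred p | (E e1 p \notin low) && (E e2 p \in low)].
pose P3 := [pred p | [&& E e1 p \notin low, E e2 p \notin low & E e3 p \in low]].
have sum_term x y z : (a *: x + b *: y + c *: z == 0)%:R =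
    \sum_(p | P1 p) term p x y z + \sum_(p | P2 p) term p x y z + \sum_(p | P3 p) term p x y z.
  transitivity (\sum_p term p x y z).
    transitivity (\prod_s (a * x 0 s + b * y 0 s + c * z 0 s == 0)%:R : F).
      have [h|h] := eqVneq.
        rewrite big1 // => s _; move/rowP/(_ s): h; rewrite !mxE => ->; by rewrite eqxx.
      have /existsP[s hs] : [exists s, a * x 0 s + b * y 0 s + c * z 0 s != 0].
        apply: contraR h; rewrite negb_exists => /forallP h; apply/eqP/rowP => s.
        by have := h s; rewrite negbK !mxE => /eqP.
      by rewrite (bigD1 s) //= (negPf hs) mul0r.
    under eq_bigr => s _ do rewrite expand.
    rewrite bigA_distr_bigA; apply: eq_bigr => p _.
    rewrite /term /Cf /Mon -!big_split; apply: eq_bigr => s _; by rewrite !ffunE.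
  rewrite (bigID P1) /= -addrA; congr (_ + _).
  rewrite (bigID P2) /=; congr (_ + _); first by apply: eq_bigl => p; rewrite /= andbA andbb.
  rewrite [LHS](bigID P3) /= [X in _ + X]big1 ?addr0.
    by apply: eq_bigl => p; rewrite /=; case: (_ \in low); case: (_ \in low).
  move=> p; rewrite /term; have [->|/deg] := eqVneq (Cf p) 0; first by rewrite !mul0r.
  by case: (_ \in low); case: (_ \in low); case: (_ \in low).
pose g1 u y z := \sum_(p | P1 p && (E e1 p == u)) Cf p * Mon (E e2 p) y * Mon (E e3 p) z.
pose g2 u x z := \sum_(p | P2 p && (E e2 p == u)) Cf p * Mon (E e1 p) x * Mon (E e3 p) z.
pose g3 u x y := \sum_(p | P3 p && (E e3 p == u)) Cf p * Mon (E e1 p) x * Mon (E e2 p) y.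
apply: (@diagonal_slice_rank _ _ _ _ low (fun x u => Mon u x) g1 g2 g3) => x y z xA yA zA.
have -> : (x == y) && (y == z) = (a *: x + b *: y + c *: z == 0).
  apply/andP/eqP => [[/eqP-> /eqP->]|/(triv _ _ _ xA yA zA)[-> ->] //].
  by rewrite -!scalerDl abc0 scale0r.
rewrite sum_term; congr (_ + _ + _).
- rewrite (partition_big (E e1) (mem low)) //=; apply: eq_bigr => u _.
  rewrite /g1 big_distrr; apply: eq_bigr => p /andP[_ /eqP <-]; rewrite /term /=; ring.
- rewrite (partition_big (E e2) (mem low)) /=; last by move=> p /andP[].
  apply: eq_bigr => u _.
  rewrite /g2 big_distrr; apply: eq_bigr => p /andP[_ /eqP <-]; rewrite /term /=; ring.
- rewrite (partition_big (E e3) (mem low)) /=; last by move=> p /and3P[].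
  apply: eq_bigr => u _.
  rewrite /g3 big_distrr; apply: eq_bigr => p /andP[_ /eqP <-]; rewrite /term /=; ring.
Qed.

(** * Exponential estimates *)

Lemma exprn_1B_bounds (R : realFieldType) (t : R) (m : nat) : 0 <= t <= 1 ->
  1 - m%:R * t <= (1 - t) ^+ m <= 1 - m%:R * t + (m%:R * t) ^+ 2.
Proof.
move=> /andP[t0 t1]; elim: m => [|m /andP[IH1 IH2]]; first by rewrite expr0; apply/andP; split; lra.
rewrite exprS -natr1; set p := (1 - t) ^+ m in IH1 IH2 *; have m0 : 0 <= m%:R :> R by [].
apply/andP; split; nra.
Qed.

(* Take [s = 1 - t] with [t] of order [1/q]: the first order gain [t q (q - 1) / 2]
   beats the second order loss [9 q^3 t^2]. *)
Lemma exp_moment_lt (R : realFieldType) (q : nat) : (2 <= q)%N ->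
  exists2 s : R, 0 < s < 1 & \sum_(i < q) s ^+ (3 * i) < q%:R * s ^+ q.-1.
Proof.
move=> q2; have q2R : 2 <= q%:R :> R by rewrite ler_nat.
pose t : R := (40 * q%:R)^-1; have tq : 40 * (q%:R * t) = 1.
  by rewrite mulrA mulfV //; lra.
have t0 : 0 < t by rewrite invr_gt0; lra.
have t1 : t < 1 by nra.
have t01 : 0 <= t <= 1 by lra.
exists (1 - t); first by lra.
have sum_le m : (m <= q)%N ->
    2 * \sum_(i < m) (1 - t) ^+ (3 * i) <= 2 * m%:R - 3 * t * (m%:R * (m%:R - 1)) + m%:R * (18 * (q%:R * t) ^+ 2).
  elim: m => [_|m IH mq]; first by rewrite big_ord0; lra.
  have mq' : m%:R + 1 <= q%:R :> R by rewrite natr1 ler_nat.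
  rewrite big_ord_recr /= -natr1; have := IH (ltnW mq).
  have /andP[_] := exprn_1B_bounds (3 * m) t01; rewrite natrM.
  have m0 : 0 <= m%:R :> R by [].
  have : (3 * m%:R * t) ^+ 2 <= 9 * (q%:R * t) ^+ 2.
    have mt : 0 <= m%:R * t <= q%:R * t by apply/andP; split; [apply: mulr_ge0|rewrite ler_pM2r //]; lra.
    rewrite -mulrA; move: mt; set u := m%:R * t; set v := q%:R * t => /andP[u0 uv]; nra.
  set S := \sum_(i < m) _; set p := (1 - t) ^+ _; set w := (q%:R * t) ^+ 2; set v := _ ^+ 2.
  move=> *; lra.
have /andP[low _] := exprn_1B_bounds q.-1 t01.
have := sum_le q (leqnn q).
have qE : q.-1%:R = q%:R - 1 :> R by rewrite -subn1 natrB // ltnW.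
rewrite qE in low.
move: low; set S := \sum_(i < q) _; set p := (1 - t) ^+ _ => low h.
have : q%:R * (1 - (q%:R - 1) * t) <= q%:R * p by rewrite ler_pM2l //; lra.
have u40 : q%:R * t = 40^-1 by lra.
have -> : q%:R * (1 - (q%:R - 1) * t) = q%:R - (q%:R - 1) * (q%:R * t) by ring.
have E : 3 * t * (q%:R * (q%:R - 1)) = 3 * (q%:R - 1) * (q%:R * t) by ring.
by rewrite E u40 in h *; lra.
Qed.

(** Exponential moment bound: with weights [s ^+ (3 * \sum_j u j)] all vectors together weigh
    [G ^+ n], and each vector of low degree at least [s ^+ (n * q.-1)]. *)
Lemma low_degree_card_bound (R : realFieldType) (q : nat) : (2 <= q)%N ->
  exists2 g : R, 0 < g < q%:R & forall n, #|low_degree q n|%:R <= g ^+ n.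
Proof.
move=> q2; have [s /andP[s0 s1] hs] := exp_moment_lt R q2.
pose G := \sum_(i < q) s ^+ (3 * i); have sp m : 0 < s ^+ m by rewrite exprn_gt0.
exists (G / s ^+ q.-1).
  rewrite ltr_pdivrMr // hs andbT divr_gt0 // /G.
  case: q q2 {hs G} => // q _; rewrite big_ord_recl ltr_pwDl //= sumr_ge0 // => i _; exact: ltW.
move=> n; rewrite expr_div_n ler_pdivlMr ?exprn_gt0 //.
have -> : G ^+ n = \sum_(u : {ffun 'I_n -> 'I_q}) s ^+ (3 * \sum_j u j).
  rewrite -[in LHS](card_ord n) -prodr_const bigA_distr_bigA; apply: eq_bigr => u _.
  by rewrite big_distrr /= -prodrXr.
rewrite [X in _ <= X](bigID (mem (low_degree q n))) /= -[X in X <= _]addr0 lerD //; last first.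
  by apply: sumr_ge0 => u _; exact: ltW.
rewrite -exprM mulr_natl -sumr_const; apply: ler_sum => u; rewrite inE => h.
by apply: ler_wiXn2l; rewrite ?ltW // [X in (_ <= X)%N]mulnC.
Qed.

Lemma bernoulli_ge (R : realFieldType) (t : R) (m : nat) : -1 <= t -> 1 + m%:R * t <= (1 + t) ^+ m.
Proof.
move=> t1; elim: m => [|m IH]; first by rewrite mul0r addr0 expr0.
rewrite exprS -natr1; have m0 : 0 <= m%:R :> R by [].
have h : (1 + t) * (1 + m%:R * t) <= (1 + t) * (1 + t) ^+ m by apply: ler_wpM2l => //; lra.
by apply: le_trans h; nra.
Qed.

Lemma exp_dominates (R : realType) (a b c : R) : 0 < a < b ->
  exists N, forall n, (N <= n)%N -> c * a ^+ n <= b ^+ n.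
Proof.
move=> /andP[a0 ab]; pose t := b / a - 1.
have t0 : 0 < t by rewrite subr_gt0 ltr_pdivlMr // mul1r.
exists (Num.truncn (`|c| / t)).+1 => n Nn.
have bE : b = a * (1 + t) by rewrite /t addrC subrK mulrC divfK // gt_eqF.
rewrite bE exprMn mulrC ler_pM2l ?exprn_gt0 //.
apply: le_trans (bernoulli_ge n _); last lra.
have : `|c| / t < n%:R.
  by apply: lt_le_trans (truncnS_gt _) _; rewrite ler_nat.
rewrite ltr_pdivrMr // => h; have := ler_norm c; lra.
Qed.

(** Room for density losses: a step that turns sets of size about [h ^+ n] into sets of size about
    [(h ^+ e.+1 / q ^+ e) ^+ n] still ends above [g ^+ n]. *)
Lemma power_gap (R : realFieldType) (q g : R) (e : nat) : 0 < g < q ->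
  exists2 h, g < h < q & g * q ^+ e < h ^+ e.+1.
Proof.
move=> /andP[g0 gq]; have q0 : 0 < q by lra.
(* By Bernoulli's inequality [(1 - t) ^+ e.+1] is at least [1 - e.+1%:R * t], the midpoint of
   [g / q] and 1. *)
pose t := (1 - g / q) / (2 * e.+1%:R).
have gq1 : g / q < 1 by rewrite ltr_pdivrMr // mul1r.
have gq0 : 0 < g / q by rewrite divr_gt0.
have e1 : 1 <= e.+1%:R :> R by rewrite ler1n.
have et : 2 * (e.+1%:R * t) = 1 - g / q by rewrite /t; field; rewrite gt_eqF //; lra.
have gE : g = q * (g / q) by rewrite mulrC divfK // gt_eqF.
have t0 : 0 < t by rewrite divr_gt0; lra.
have tle : t <= e.+1%:R * t by rewrite ler_peMl // ltW.
exists (q * (1 - t)).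
  rewrite {1}gE ltr_pM2l // -[X in _ && (_ < X)]mulr1 ltr_pM2l //; lra.
rewrite exprMn {1}gE mulrAC exprS ltr_pM2l; last by rewrite mulr_gt0 ?exprn_gt0.
have := @bernoulli_ge R (- t) e.+1; rewrite mulrN => /(_ ltac:(lra)) h.
by apply: lt_le_trans h; lra.
Qed.

(** * Rich subsets: sums with many representations *)

Section Rich.
Variables (F : finFieldType) (n : nat).
Implicit Types (S I Q : {set 'rV[F]_n}) (a b : F) (x y u : 'rV[F]_n).

(** For [b != 0], the solutions of [a u + b u' = y] over [S], recorded by [u]. *)
Definition representations S a b y := [set u in S | b^-1 *: (y - a *: u) \in S].

(** When [x = x'] and [a + b = 0] the sum is 0, represented only by [u = u']; this case is left out.
    [Q] will be the set of values that a solution already takes. *)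
Definition rich_in (m : nat) S S' := forall a b x x', a != 0 -> b != 0 ->
  x \in S' -> x' \in S' -> (x != x') || (a + b != 0) ->
  forall Q, (#|Q| <= m)%N -> exists u u', [/\ u \in S, u' \in S, u \notin Q, u' \notin Q & u != u']
    /\ a *: u + b *: u' = a *: x + b *: x'.

Lemma representations_avoid S a b y (m : nat) Q : a != 0 -> b != 0 ->
  (y != 0) || (a + b != 0) -> (2 * m + 1 < #|representations S a b y|)%N -> (#|Q| <= m)%N ->
  exists u u', [/\ u \in S, u' \in S, u \notin Q, u' \notin Q & u != u'] /\ a *: u + b *: u' = y.
Proof.
move=> a0 b0 yab many Qm.
(* The three parts exclude [u] in [Q], [u'] in [Q] and [u = u'], at a cost of at most [2 * m + 1]
   points. *)
pose Bad := Q :|: [set a^-1 *: (y - b *: v) | v in Q] :|: [set (a + b)^-1 *: y].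
have : (#|Bad| <= 2 * m + 1)%N.
  rewrite (leq_trans (leq_card_setU _ _)) // cards1 leq_add2r (leq_trans (leq_card_setU _ _)) //.
  by rewrite mul2n -addnn leq_add // (leq_trans (leq_imset_card _ _)).
move=> few; have /subsetPn[u uR uBad] : ~~ (representations S a b y \subset Bad).
  by apply: contraL many => /subset_leq_card h; rewrite -leqNgt (leq_trans h).
move: uR uBad; rewrite !inE => /andP[uS u'S] /norP[/norP[uQ /negP u'Q] uab].
set u' := b^-1 *: (y - a *: u) in u'S *.
have E : a *: u + b *: u' = y by rewrite scalerA mulfV // scale1r addrC subrK.
exists u, u'; split=> //; split=> //.
  apply/negP => h; apply: u'Q; apply/imsetP; exists u' => //.
  by rewrite -E addrK scalerA mulVf // scale1r.
apply/eqP => uu'; move: E; rewrite -uu' -scalerDl => E.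
have [ab0|ab0] := eqVneq (a + b) 0; first by move: yab; rewrite -E ab0 scale0r !eqxx.
by move: uab; rewrite -E scalerA mulVf // scale1r eqxx.
Qed.

(** Join a poor [x] to the first entries [u] of the representations of [(a + b) x]: out-degrees are
    at most [K], and an independent set has only trivial solutions of [a u + b u' = (a + b) x], so
    the cap set bound applies to it. *)
Lemma few_poor_points S a b (K : nat) : a != 0 -> b != 0 ->
  (#|[set x in S | #|representations S a b ((a + b) *: x)| <= K]| <=
     6 * (1 + 4 * K) * #|low_degree #|F| n|)%N.
Proof.
move=> a0 b0; set B := [set x in S | _].
pose e x u := u \in representations S a b ((a + b) *: x).
have [I [IB Iind Ibig]] := sparse_indep e B.
have Ilow : (#|I| <= 3 * #|low_degree #|F| n|)%N.
  apply: (@trivial_solutions_card F n a b (- (a + b))); first by rewrite subrr.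
  move=> u u' x uI u'I xI /eqP; rewrite scaleNr subr_eq0 => /eqP E.
  have IS v : v \in I -> v \in S by move=> /(subsetP IB); rewrite inE => /andP[].
  have [xu|xu] := eqVneq x u; last first.
    have := Iind _ _ xI uI xu; rewrite /e inE IS //= -E [X in X - _]addrC addrK.
    by rewrite scalerA mulVf // scale1r IS.
  move: E; rewrite -xu scalerDl => /addrI /(scalerI b0) ->; by split.
have edges : (\sum_(x in B) #|[set y in B | e x y]| <= #|B| * K)%N.
  rewrite -sum_nat_const; apply: leq_sum => x; rewrite inE => /andP[_]; apply: leq_trans.
  by apply: subset_leq_card; apply/subsetP => y; rewrite inE => /andP[].
move: Ibig edges Ilow; set E := (\sum_(x in B) _)%N; set L := #|low_degree _ _|.
move: #|B| #|I| E L => bb ii E L h1 h2 h3.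
have [->//|bpos] := posnP bb.
have : (bb * bb <= bb * (2 * ii * (1 + 4 * K)))%N by nia.
by rewrite leq_pmul2l //; nia.
Qed.

(** For fixed [a], [b], each of the at most [#|F| ^ n] poor sums comes from at most [K] pairs of
    [S1], as these are representations over [S]. The graph of poor pairs is therefore sparse. *)
Lemma few_poor_pairs S S1 (K : nat) : S1 \subset S ->
  exists I, [/\ I \subset S1,
    forall a b x x', a != 0 -> b != 0 -> x \in I -> x' \in I -> x != x' ->
      (K < #|representations S a b (a *: x + b *: x')|)%N &
    (#|S1| ^ 2 <= 2 * #|I| * (1 + 4 * (#|F| ^ 2 * K)) * #|F| ^ n)%N].
Proof.
move=> S1S; pose poor a b y := (#|representations S a b y| <= K)%N.
pose P (p : F * F) x x' := [&& p.1 != 0, p.2 != 0 & poor p.1 p.2 (p.1 *: x + p.2 *: x')].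
pose e x x' := [exists p : F * F, P p x x'].
have [I [IS1 Iind Ibig]] := sparse_indep e S1.
exists I; split=> // [a b x x' a0 b0 xI x'I xx'|].
  have := Iind _ _ xI x'I xx'; rewrite negb_exists => /forallP/(_ (a, b)).
  by rewrite /P a0 b0 /= -ltnNge.
have cardV : #|{: 'rV[F]_n}| = (#|F| ^ n)%N by rewrite card_mx mul1n.
have edges : (\sum_(x in S1) #|[set y in S1 | e x y]| <= #|F| ^ 2 * K * #|F| ^ n)%N.
  apply: (@leq_trans (\sum_(x in S1) \sum_(p : F * F) #|[set y in S1 | P p x y]|)%N).
    apply: leq_sum => x _.
    have sub : [set y in S1 | e x y] \subset \bigcup_(p : F * F) [set y in S1 | P p x y].
      apply/subsetP => y; rewrite inE => /andP[yS1 /existsP[p Pp]].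
      by apply/bigcupP; exists p => //; rewrite inE yS1.
    apply: leq_trans (subset_leq_card sub) _.
    elim/big_rec2: _ => [|p k A _ h]; first by rewrite cards0.
    by rewrite (leq_trans (leq_card_setU _ _)) // leq_add2l.
  rewrite exchange_big /= -mulnA -[X in (_ <= X * _)%N](_ : #|{: F * F}| = _); last first.
    by rewrite card_prod mulnn.
  rewrite -sum_nat_const; apply: leq_sum => -[a b] _.
  have [a0|a0] := eqVneq a 0.
    by rewrite big1 // => x _; apply: eq_card0 => y; rewrite inE /P a0 eqxx andbF.
  have [b0|b0] := eqVneq b 0.
    by rewrite big1 // => x _; apply: eq_card0 => y; rewrite inE /P b0 eqxx !andbF.
  (* Edges at [x] are counted by the value [y] of the sum instead of by the second endpoint. *)
  have shift x : #|[set y in S1 | P (a, b) x y]| =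
      (\sum_(y | poor a b y) (b^-1 *: (y - a *: x) \in S1))%N.
    rewrite -sum1dep_card big_mkcond /= (reindex (fun y => b^-1 *: (y - a *: x))) /=; last first.
      exists (fun z => a *: x + b *: z) => z _ /=.
        by rewrite scalerA mulfV // scale1r addrC subrK.
      by rewrite [X in X - _]addrC addrK scalerA mulVf // scale1r.
    rewrite [RHS]big_mkcond; apply: eq_bigr => y _.
    have -> : P (a, b) x (b^-1 *: (y - a *: x)) = poor a b y.
      by rewrite /P /= a0 b0 scalerA mulfV // scale1r [a *: x + _]addrC subrK.
    by case: (_ \in S1); case: (poor _ _ _).
  under eq_bigr => x _ do rewrite shift.
  rewrite exchange_big /= mulnC -cardV -sum_nat_const big_mkcond /=; apply: leq_sum => y _.
  case: ifP => // /(leq_trans _); apply.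
  rewrite -big_mkcondr /= sum1dep_card; apply: subset_leq_card.
  by apply/subsetP => x; rewrite !inE => /andP[/(subsetP S1S)-> /(subsetP S1S)].
have := max_card S1; rewrite cardV.
move: Ibig edges; set E := (\sum_(x in S1) _)%N; set qn := (_ ^ n)%N; set c := (_ * K)%N.
move: #|S1| #|I| E qn c => s i E qn c h1 h2 h3; nia.
Qed.
End Rich.

(** Poor points are negligible once [g] exceeds the growth rate [g0] of [low_degree]; removing poor
    pairs leaves a set of order [#|S| ^ 2 / #|F| ^ n], whence the requirement [g1 < g ^+ 2 / q]. *)
Lemma rich_subset (R : realType) (F : finFieldType) (m : nat) (g1 : R) : 0 < g1 < #|F|%:R ->
  exists2 g : R, 0 < g < #|F|%:R & exists N, forall n (S : {set 'rV[F]_n}), (N <= n)%N ->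
    g ^+ n <= #|S|%:R -> exists S' : {set 'rV[F]_n},
      [/\ S' \subset S, rich_in m S S' & g1 ^+ n <= #|S'|%:R].
Proof.
move=> /andP[g1_gt0 g1q]; set q : R := #|F|%:R in g1q *.
have q0 : 0 < q by lra.
have [g0 /andP[g0_gt0 g0q] low] := low_degree_card_bound R (finNzRing_gt1 F).
have [g /andP[gm gq] gap] : exists2 h, Num.max g0 g1 < h < q & Num.max g0 g1 * q ^+ 1 < h ^+ 2.
  by apply: power_gap; rewrite lt_max g0_gt0 gt_max g0q g1q.
have [gg0 gg1] : g0 < g /\ g1 < g by move: gm; rewrite gt_max => /andP[].
have gap1 : g1 < g ^+ 2 / q.
  rewrite ltr_pdivlMr //; apply: le_lt_trans gap.
  by rewrite expr1 ler_pM2r // le_max lexx orbT.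
have g_gt0 : 0 < g by lra.
(* [K] is the threshold of [representations_avoid]; the factors [#|F| ^ 2] come from the pairs
   [(a, b)]. *)
pose K := (2 * m + 1)%N; pose c0 := (#|F| ^ 2 * (6 * (1 + 4 * K)))%N.
pose c1 := (2 * (1 + 4 * (#|F| ^ 2 * K)))%N.
have [N0 hN0] := @exp_dominates R g0 g (2 * c0%:R) ltac:(lra).
have [N1 hN1] := @exp_dominates R g1 (g ^+ 2 / q) (4 * c1%:R) ltac:(lra).
exists g; first by rewrite g_gt0.
exists (maxn N0 N1) => n S; rewrite geq_max => /andP[/hN0 h0 /hN1 h1] gS.
pose bad (p : F * F) := [set x in S | [&& p.1 != 0, p.2 != 0 &
  (#|representations S p.1 p.2 ((p.1 + p.2) *: x)| <= K)%N]].
pose B := \bigcup_p bad p.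
have cardB : (#|B| <= c0 * #|low_degree #|F| n|)%N.
  apply: (@leq_trans (\sum_(p : F * F) #|bad p|)%N).
    rewrite /B; elim/big_rec2: _ => [|p k A _ h]; first by rewrite cards0.
    by rewrite (leq_trans (leq_card_setU _ _)) // leq_add2l.
  rewrite /c0 -mulnA -[X in (_ <= X * _)%N](_ : #|{: F * F}| = _); last first.
    by rewrite card_prod mulnn.
  rewrite -sum_nat_const; apply: leq_sum => -[a b] _.
  have [a0|a0] := eqVneq a 0.
    by rewrite [bad _](_ : _ = set0) ?cards0 //; apply/setP => x; rewrite !inE /= a0 eqxx andbF.
  have [b0|b0] := eqVneq b 0.
    by rewrite [bad _](_ : _ = set0) ?cards0 //; apply/setP => x; rewrite !inE /= b0 eqxx !andbF.
  apply: leq_trans (few_poor_points S K a0 b0); apply: subset_leq_card.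
  by apply/subsetP => x; rewrite !inE a0 b0.
have [I [IS1 Ipairs Ibig]] := few_poor_pairs K (subsetDl S B).
exists I; split; first exact: subset_trans IS1 (subsetDl _ _).
  move=> a b x x' a0 b0 xI x'I xx' Q Qm; apply: (@representations_avoid _ _ _ _ _ _ m) => //.
    have [ab0|ab0] := eqVneq (a + b) 0; last by rewrite orbT.
    move: xx'; rewrite ab0 eqxx !orbF; apply: contraNneq.
    have -> : b = - a by apply/eqP; rewrite -addr_eq0 addrC ab0.
    by rewrite scaleNr => /eqP; rewrite subr_eq0 => /eqP/(scalerI a0)->.
  have [xx|xx] := eqVneq x x'; last exact: Ipairs.
  have /(subsetP IS1) := xI; rewrite inE => /andP[xB xS]; rewrite -xx -scalerDl ltnNge.
  apply: contra xB => h; apply/bigcupP; exists (a, b) => //; by rewrite inE xS a0 b0.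
have S1big : g ^+ n <= 2 * #|S :\: B|%:R.
  have : #|S|%:R <= #|S :\: B|%:R + #|B|%:R :> R.
    by rewrite -natrD ler_nat -(cardsID B S) addnC leq_add2l subset_leq_card // subsetIr.
  have : 2 * #|B|%:R <= g ^+ n.
    apply: le_trans h0; rewrite -mulrA ler_pM2l // (@le_trans _ _ (c0 * #|low_degree #|F| n|)%:R) ?ler_nat //.
    by rewrite natrM ler_wpM2l.
  lra.
have qn0 : 0 < q ^+ n by rewrite exprn_gt0.
have : g ^+ n * g ^+ n <= 4 * c1%:R * #|I|%:R * q ^+ n.
  move: Ibig; rewrite -(ler_nat R) /c1 !natrM !natrX -/q => h.
  have gn0 : 0 <= g ^+ n by rewrite exprn_ge0 // ltW.
  apply: (@le_trans _ _ (4 * (#|S :\: B|%:R ^+ 2))); first by rewrite expr2; nra.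
  rewrite -2!mulrA ler_pM2l //; apply: (le_trans h).
  by rewrite !mulrA [2 * #|I|%:R * _]mulrAC.
rewrite -expr2 -exprM mulnC exprM -ler_pdivrMr // -expr_div_n => h2.
have : 4 * c1%:R * g1 ^+ n <= 4 * c1%:R * #|I|%:R by apply: le_trans h2.
rewrite ler_pM2l // mulr_gt0 // ltr0n /c1; lia.
Qed.

(** * Column equivalence classes *)

Section Classes.
Variables (F : finFieldType) (m k : nat) (A : 'M[F]_(m, k)).
Implicit Types (i j l : 'I_k).

Lemma mem_col_class i l :
  reflect (exists2 c, c != 0 & col i A = c *: col l A) (l \in col_class A i).
Proof.
rewrite inE; apply: (iffP existsP) => [[c /andP[c0 /eqP E]]|[c c0 ->]]; first by exists c.
by exists c; rewrite c0 eqxx.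
Qed.

Lemma col_class_refl i : i \in col_class A i.
Proof. by apply/mem_col_class; exists 1; rewrite ?oner_eq0 ?scale1r. Qed.

Lemma col_class_in_classes i : col_class A i \in col_classes A.
Proof. exact: imset_f. Qed.

Lemma col_class_eq i l : l \in col_class A i -> col_class A l = col_class A i.
Proof.
case/mem_col_class=> c c0 E; apply/setP => j; apply/mem_col_class/mem_col_class => -[d d0 Ej].
  by exists (c * d); rewrite ?mulf_neq0 // E Ej scalerA.
by exists (c^-1 * d); rewrite ?mulf_neq0 ?invr_eq0 // -scalerA -Ej E scalerA mulVf // scale1r.
Qed.

(** Of two coinciding coordinates, at least one has a partner in its class with which it can be
    moved. *)
Lemma col_class_nontrivial i j : (#|[set C in col_classes A | #|C| == 1%N]| <= 1)%N -> i != j ->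
  (exists2 l, l != i & l \in col_class A i) \/ (exists2 l, l != j & l \in col_class A j).
Proof.
move=> single ij.
have nontriv p : #|col_class A p| != 1%N -> exists2 l, l != p & l \in col_class A p.
  move=> h; have /card_gt0P[l] : (0 < #|col_class A p :\ p|)%N.
    by move: h; rewrite (cardsD1 p (col_class A p)) col_class_refl; case: #|_|.
  by rewrite !inE => /andP[]; exists l => //; rewrite inE.
have [i1|/nontriv] := eqVneq #|col_class A i| 1%N; last by left.
have [j1|/nontriv] := eqVneq #|col_class A j| 1%N; last by right.
have mem p : #|col_class A p| = 1%N -> col_class A p \in [set C in col_classes A | #|C| == 1%N].
  by move=> h; rewrite inE h eqxx col_class_in_classes.
have E : col_class A i = col_class A j by apply: (card_le1_eqP single); apply: mem.
have /eqP/cards1P[p Ep] := i1.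
by have := col_class_refl i; have := col_class_refl j; rewrite -E Ep !inE => /eqP <-; rewrite (negPf ij).
Qed.

End Classes.

(** * Removing coincidences from a solution *)

Section Spread.
Variables (F : finFieldType) (m k n : nat) (A : 'M[F]_(m, k)).
Implicit Types (i j l : 'I_k) (x : 'I_k -> 'rV[F]_n).

(* A pair of opposite columns forming a whole class must receive distinct
   values from the start: its two values can only be moved together. *)
Definition separated x := forall i l, i != l -> #|col_class A i| = 2%N ->
  l \in col_class A i -> col i A + col l A = 0 -> x i != x l.

Definition update2 x i l u u' j := if j == i then u else if j == l then u' else x j.

Lemma update2_solution x i l u u' : i != l -> is_solution A x ->
  (forall r, A r i *: u + A r l *: u' = A r i *: x i + A r l *: x l) ->
  is_solution A (update2 x i l u u').
Proof.
move=> il solx E r; have li : l != i by rewrite eq_sym.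
have split_sum (G : 'I_k -> 'rV[F]_n) :
    \sum_j G j = G i + G l + \sum_(j | (j != i) && (j != l)) G j.
  by rewrite (bigD1 i) //= (bigD1 l) //= addrA.
rewrite -[RHS](solx r) 2!split_sum /update2 eqxx (negPf li) eqxx E; congr (_ + _).
by apply: eq_bigr => j /andP[ji jl]; rewrite (negPf ji) (negPf jl).
Qed.

(** The coordinate [j] keeps the old value of [x i] alive, so only the value [x l] can get lost. *)
Lemma update2_values x i l u u' j : j != i -> x j = x i ->
  (x @: [set: 'I_k]) :\ x l \subset update2 x i l u u' @: [set: 'I_k].
Proof.
move=> ji xji; apply/subsetP => v; rewrite !inE => /andP[vl /imsetP[p _ vp]].
have pl : p != l by apply: contraNneq vl => <-; rewrite vp.
have [pi|pi] := eqVneq p i; last first.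
  by apply/imsetP; exists p => //; rewrite /update2 (negPf pi) (negPf pl).
have jl : j != l by apply: contraNneq vl => <-; rewrite vp pi xji.
by apply/imsetP; exists j => //; rewrite /update2 (negPf ji) (negPf jl) vp pi xji.
Qed.

(** Two fresh values are gained and at most one is lost; fresh values differ from each other and
    from all remaining ones, which preserves separation. *)
Lemma update2_pair x i l u u' j : i != l -> j != i -> x j = x i -> separated x ->
  u \notin x @: [set: 'I_k] -> u' \notin x @: [set: 'I_k] -> u != u' ->
  separated (update2 x i l u u') /\
  (#|x @: [set: 'I_k]| < #|update2 x i l u u' @: [set: 'I_k]|)%N.
Proof.
move=> il ji xji sepx uN u'N uu'; split.
  have xN v p : v \notin x @: [set: 'I_k] -> v != x p.
    by apply: contraNneq => ->; apply: imset_f.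
  move=> p p' pp' c2 p'p opp; rewrite /update2.
  have [pi|pi] := eqVneq p i.
    have [p'i|p'i] := eqVneq p' i; first by rewrite pi p'i eqxx in pp'.
    by case: ifP => // _; apply: xN.
  have [p'i|p'i] := eqVneq p' i.
    by case: ifP => // _; rewrite eq_sym //; apply: xN.
  have [pl|pl] := eqVneq p l.
    have [p'l|p'l] := eqVneq p' l; first by rewrite pl p'l eqxx in pp'.
    exact: xN.
  by have [p'l|p'l] := eqVneq p' l; [rewrite eq_sym; apply: xN|apply: sepx].
have sub : u |: (u' |: (x @: [set: 'I_k] :\ x l)) \subset update2 x i l u u' @: [set: 'I_k].
  rewrite !subUset !sub1set (update2_values l u u' ji xji) andbT; apply/andP; split; apply/imsetP.
    by exists i => //; rewrite /update2 eqxx.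
  by exists l => //; rewrite /update2 eq_sym (negPf il) eqxx.
apply: leq_trans (subset_leq_card sub); rewrite !cardsU1 !inE (negPf uu') (negPf uN) (negPf u'N) !andbF /=.
by rewrite (cardsD1 (x l) (x @: _)) imset_f.
Qed.

Lemma spread_step (S S' : {set 'rV[F]_n}) x : S' \subset S -> rich_in k S S' -> (k < #|S'|)%N ->
  (#|[set C in col_classes A | #|C| == 1%N]| <= 1)%N ->
  is_solution A x -> separated x -> (forall j, x j \in S') -> (#|x @: [set: 'I_k]| < k)%N ->
  exists x', [/\ is_solution A x', separated x', forall j, x' j \in S &
    (#|x @: [set: 'I_k]| < #|x' @: [set: 'I_k]|)%N].
Proof.
move=> SS rich bigS single solx sepx xS few.
have few' : (#|x @: [set: 'I_k]| <= k)%N by exact: ltnW.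
have [i [l [j [li lC ji xji]]]] : exists i l j,
    [/\ l != i, l \in col_class A i, j != i & x j = x i].
  have /injectivePn[i [j ij xij]] : ~~ injectiveb x.
    by apply: contraL few => /injectiveP h; rewrite card_imset // cardsT card_ord ltnn.
  by case: (col_class_nontrivial single ij) => -[l ? ?]; [exists i, l, j|exists j, l, i]; split=> //; rewrite eq_sym.
(* The generic move: [i] moves together with [p] from its class, and [q] retains the old value of
   [x i]. *)
have pair p c q : p != i -> col i A = c *: col p A -> c != 0 -> (x i != x p) || (c + 1 != 0) ->
    q != i -> x q = x i -> exists x', [/\ is_solution A x', separated x', forall j, x' j \in S &
    (#|x @: [set: 'I_k]| < #|x' @: [set: 'I_k]|)%N].
  move=> pi E c0 h qi xq.
  have [u [u' [[uS u'S uN u'N uu'] Eu]]] := rich c 1 (x i) (x p) c0 (oner_neq0 _) (xS i) (xS p) h _ few'.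
  exists (update2 x i p u u'); have ip : i != p by rewrite eq_sym.
  have [sep more] := update2_pair ip qi xq sepx uN u'N uu'; split=> //.
    apply: update2_solution => // r; have -> : A r i = c * A r p.
      by have /colP/(_ r) := E; rewrite !mxE.
    have scale v v' : (c * A r p) *: v + A r p *: v' = A r p *: (c *: v + 1 *: v').
      by rewrite scale1r scalerDr scalerA mulrC.
    by rewrite !scale Eu.
  by move=> t; rewrite /update2; case: ifP => // _; case: ifP => // _; apply: (subsetP SS).
have /mem_col_class[c c0 Ec] := lC.
have [|] := boolP ((x i != x l) || (c + 1 != 0)); first by move=> h; apply: (pair l c j).
rewrite negb_or !negbK => /andP[/eqP xil /eqP c1].
have opp : col i A + col l A = 0 by rewrite Ec -[X in _ + X]scale1r -scalerDl c1 scale0r.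
have il : i != l by rewrite eq_sym.
(* In the case left by [pair], separation rules out a class of size two, so there is a third index
   [h]. *)
have card2 : #|col_class A i| <> 2%N by move=> h; have := sepx i l il h lC opp; rewrite xil eqxx.
have [h [hC hi hl]] : exists h, [/\ h \in col_class A i, h != i & h != l].
  have /card_gt0P[h] : (0 < #|col_class A i :\ i :\ l|)%N.
    move: card2; rewrite (cardsD1 i (col_class A i)) col_class_refl (cardsD1 l (_ :\ i)) in_setD1 li lC.
    by case: #|_|.
  by rewrite !in_setD1 => /and3P[]; exists h.
have /mem_col_class[c' c'0 Ec'] := hC.
have [xih|xih] := eqVneq (x i) (x h); last by apply: (pair h c' l) => //; rewrite ?xih.
(* Now [x i = x l = x h]: the opposite coordinates [i], [l] move to a common fresh value, while [h]
   retains the old one. *)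
have /subsetPn[v vS vN] : ~~ (S' \subset x @: [set: 'I_k]).
  by apply: contraL bigS => /subset_leq_card h'; rewrite -leqNgt (leq_trans h').
exists (update2 x i l v v); split.
- apply: update2_solution => // r; rewrite xil -!scalerDl.
  by have /colP/(_ r) := opp; rewrite !mxE => ->; rewrite !scale0r.
- move=> p p' pp' p2 p'p opp'; rewrite /update2.
  have pi : p != i by apply: contra_not_neq card2 => <-.
  have pl : p != l by apply: contra_not_neq card2 => pl; rewrite -(col_class_eq lC) -pl.
  have p2' : #|col_class A p'| = 2%N by rewrite (col_class_eq p'p).
  have p'i : p' != i by apply: contra_not_neq card2 => <-.
  have p'l : p' != l by apply: contra_not_neq card2 => p'l; rewrite -(col_class_eq lC) -p'l.
  by rewrite (negPf pi) (negPf pl) (negPf p'i) (negPf p'l); apply: sepx.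
- by move=> t; rewrite /update2; do !case: ifP => // _; apply: (subsetP SS).
have sub : v |: (x @: [set: 'I_k]) \subset update2 x i l v v @: [set: 'I_k].
  rewrite subUset sub1set; apply/andP; split; first by apply/imsetP; exists i => //; rewrite /update2 eqxx.
  apply/subsetP => w wx; have [wl|wl] := eqVneq w (x l).
    by apply/imsetP; exists h => //; rewrite /update2 (negPf hi) (negPf hl) wl -xih.
  by apply: (subsetP (update2_values l v v ji xji)); rewrite in_setD1 wl.
by apply: leq_trans (subset_leq_card sub); rewrite cardsU1 vN.
Qed.
End Spread.

(** [d] bounds the number of missing values. Each step gains a value and climbs one set in a chain
    of rich subsets from [T] up to [S]. *)
Lemma spread (R : realType) (F : finFieldType) (m k : nat) (A : 'M[F]_(m, k)) (d : nat) (g1 : R) :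
  (#|[set C in col_classes A | #|C| == 1%N]| <= 1)%N -> 0 < g1 < #|F|%:R ->
  exists2 g : R, 0 < g < #|F|%:R & exists N, forall n (S : {set 'rV[F]_n}), (N <= n)%N ->
    g ^+ n <= #|S|%:R -> exists T : {set 'rV[F]_n},
      [/\ T \subset S, g1 ^+ n <= #|T|%:R &
        (k < #|T|)%N -> forall x, is_solution A x -> separated A x -> (forall j, x j \in T) ->
          (k <= #|x @: [set: 'I_k]| + d)%N ->
        exists x', is_shape A x' /\ forall j, x' j \in S].
Proof.
move=> single; elim: d g1 => [|d IH] g1 g1q.
  exists g1 => //; exists 0%N => n S _ gS; exists S; split=> // _ x solx _ xS; rewrite addn0 => kx.
  exists x; split=> //; split=> //; apply/injectiveP; rewrite /injectiveb /dinjectiveb.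
  have /imset_injP h : #|x @: [set: 'I_k]| == #|[set: 'I_k]|.
    by rewrite eqn_leq leq_imset_card cardsT card_ord kx.
  by apply/injectiveP => i j; apply: h; rewrite inE.
have [g2 g2q [N2 rich]] := rich_subset k g1q.
have [g gq [N1 spr]] := IH g2 g2q.
exists g => //; exists (maxn N1 N2) => n S; rewrite geq_max => /andP[n1 n2] gS.
have [T1 [T1S g2T1 spr1]] := spr n S n1 gS.
have [T [TT1 richT g1T]] := rich n T1 n2 g2T1.
exists T; split=> //; first exact: subset_trans T1S.
move=> kT x solx sepx xT kx; have kT1 := leq_trans kT (subset_leq_card TT1).
have [few|many] := ltnP #|x @: [set: 'I_k]| k; last first.
  apply: (spr1 kT1 x) => //; first by move=> j; apply: (subsetP TT1).
  by rewrite (leq_trans many) // leq_addr.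
have [x' [solx' sepx' x'T1 more]] := spread_step TT1 richT kT single solx sepx xT few.
apply: (spr1 kT1 x') => //; apply: leq_trans kx _; rewrite addnS -addSn leq_add2r //.
Qed.

(** * Popular differences *)

Lemma sum_sqr_le (T : finType) (f : T -> nat) :
  ((\sum_z f z) ^ 2 <= #|T| * \sum_z f z ^ 2)%N.
Proof.
rewrite -(leq_pmul2l (isT : 0 < 2)%N) -mulnn big_distrl /= big_distrr /=.
apply: (@leq_trans (\sum_z \sum_z' (f z ^ 2 + f z' ^ 2))%N).
  apply: leq_sum => z _; rewrite big_distrr /= big_distrr; apply: leq_sum => z' _; exact: nat_Cauchy.
rewrite eq_leq //; under eq_bigr => z _ do rewrite big_split /= sum_nat_const.
by rewrite big_split /= sum_nat_const -big_distrr /= mul2n addnn.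
Qed.

Section CommonDifference.
Variables (F : finFieldType) (n k : nat) (w : 'I_k -> F) (S : 'I_k -> {set 'rV[F]_n}).

Definition translates (X : {set 'rV[F]_n}) a := [set x in X | x + a \in X].

(* Cauchy-Schwarz for the number of [t] with [z_j + w_j t \in S_j] for all [j],
   as a function of [z]. *)
Lemma card_translates_energy :
  ((\prod_j #|S j|) ^ 2 * #|F| ^ n <=
     (#|F| ^ n) ^ k * \sum_a \prod_j #|translates (S j) (w j *: a)|)%N.
Proof.
have cardV : #|{: 'rV[F]_n}| = (#|F| ^ n)%N by rewrite card_mx mul1n.
have qn : (0 < #|F| ^ n)%N by rewrite expn_gt0 (ltnW (finNzRing_gt1 F)).
pose f (z : {ffun 'I_k -> 'rV[F]_n}) := (\sum_t \prod_j ((z j + w j *: t)%R \in S j))%N.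
have shift X (u : 'rV[F]_n) : (\sum_v ((v + u)%R \in X) = \sum_v (v \in X))%N.
  rewrite [RHS](reindex_onto (fun v => v + u) (fun v => v - u)) /=; last by move=> v _; rewrite subrK.
  by apply: eq_bigl => v; rewrite addrK eqxx.
have sum1 : (\sum_z f z = #|F| ^ n * \prod_j #|S j|)%N.
  rewrite /f exchange_big /= -cardV -sum_nat_const; apply: eq_bigr => t _.
  rewrite -(bigA_distr_bigA (fun j v => (v + w j *: t \in S j) : nat)).
  by apply: eq_bigr => j _; rewrite shift -sum1_card [RHS]big_mkcond.
(* The square counts pairs [t], [t + a]; shifting each [z j] by [w j *: t] makes the count
   independent of [t]. *)
have sum2 : (\sum_z f z ^ 2 = #|F| ^ n * \sum_a \prod_j #|translates (S j) (w j *: a)|)%N.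
  under eq_bigr => z _ do rewrite -mulnn big_distrl /=.
  rewrite exchange_big /= -cardV -sum_nat_const; apply: eq_bigr => t _.
  under eq_bigr => z _ do rewrite big_distrr /=.
  rewrite exchange_big /= (reindex_onto (fun a => t + a) (fun t' => t' - t)) /=; last first.
    by move=> a _; rewrite addrC subrK.
  apply: eq_big => [a|a _]; first by rewrite addrC addKr eqxx.
  under eq_bigr => z _ do rewrite -big_split /=.
  rewrite -(bigA_distr_bigA (fun j v => ((v + w j *: t)%R \in S j) * ((v + w j *: (t + a))%R \in S j))%N).
  apply: eq_bigr => j _.
  transitivity (\sum_v ((v + w j *: t)%R \in translates (S j) (w j *: a)))%N.
    by apply: eq_bigr => v _; rewrite inE mulnb scalerDr addrA.
  by rewrite shift -sum1_card [RHS]big_mkcond.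
have := sum_sqr_le f; rewrite sum1 sum2 card_ffun cardV card_ord.
set P := (\prod_j _)%N; set E := (\sum_a _)%N; set Z := ((_ ^ n) ^ k)%N.
rewrite expnMn mulnCA -mulnn -mulnA leq_pmul2l //.
by rewrite [(P ^ 2 * _)%N]mulnC.
Qed.
End CommonDifference.

(** Otherwise every [a] outside [Q] has a small factor in its product, and the at most [c] others
    cannot make up for it, so the energy falls below the Cauchy-Schwarz bound. *)
Lemma popular_difference (R : realType) (F : finFieldType) (k c : nat) (g1 : R) : 0 < g1 < #|F|%:R ->
  exists2 g : R, 0 < g < #|F|%:R & exists N, forall n (w : 'I_k -> F) (S : 'I_k -> {set 'rV[F]_n})
    (Q : {set 'rV[F]_n}), (N <= n)%N -> (forall j, g ^+ n <= #|S j|%:R) -> (#|Q| <= c)%N ->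
    exists2 a, a \notin Q & forall j, g1 ^+ n <= #|translates (S j) (w j *: a)|%:R.
Proof.
move=> /andP[g1_gt0 g1q]; set q : R := #|F|%:R in g1q *.
have q1 : 1 < q by rewrite ltr1n finNzRing_gt1.
(* A rate of at least 1 also absorbs the constant [c] contributed by [Q]. *)
pose gm := Num.max g1 1.
have gm1 : 1 <= gm by rewrite le_max lexx orbT.
have gmg1 : g1 <= gm by rewrite le_max lexx.
have [g /andP[gmg gq] gap] : exists2 h, gm < h < q & gm * q ^+ (2 * k) < h ^+ (2 * k).+1.
  by apply: power_gap; rewrite gt_max g1q q1 andbT lt_max g1_gt0.
have g0 : 0 < g by lra.
have qk0 m : 0 < q ^+ m by rewrite exprn_gt0 //; lra.
have gapq : gm < q * g ^+ (2 * k) / q ^+ (2 * k).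
  rewrite ltr_pdivlMr // (lt_trans gap) // exprS ltr_pM2r // exprn_gt0 //.
have [N hN] := @exp_dominates R gm (q * g ^+ (2 * k) / q ^+ (2 * k)) (c%:R + 2) ltac:(lra).
exists g; first by rewrite g0.
exists N => n w S Q /hN big Sbig Qc.
have cardV : #|{: 'rV[F]_n}|%:R = q ^+ n by rewrite card_mx mul1n natrX.
have [/existsP[a /andP[aQ /forallP h]]|none] := boolP [exists a, (a \notin Q) &&
    [forall j, g1 ^+ n <= #|translates (S j) (w j *: a)|%:R]]; first by exists a.
exfalso; pose r a j : R := #|translates (S j) (w j *: a)|%:R.
have rq a j : 0 <= r a j <= q ^+ n by rewrite ler0n -cardV ler_nat max_card.
have prod_le (P : pred 'I_k) a : \prod_(j | P j) r a j <= \prod_(j | P j) q ^+ n.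
  by apply: ler_prod => j _; apply: rq.
have qnk : \prod_(j < k) q ^+ n = q ^+ n ^+ k by rewrite prodr_const card_ord.
have prod_small a : a \notin Q -> q ^+ n * \prod_j r a j <= g1 ^+ n * q ^+ n ^+ k.
  move=> aQ; have : ~~ [forall j, g1 ^+ n <= r a j].
    by apply: contraNN none => h; apply/existsP; exists a; rewrite aQ.
  rewrite negb_forall => /existsP[j]; rewrite -ltNge => /ltW rj.
  rewrite (bigD1 j) //= -qnk [X in _ <= _ * X](bigD1 j) //= mulrCA.
  apply: ler_pM; rewrite /r //; first by apply: mulr_ge0; [exact: ltW | exact: prodr_ge0].
  by rewrite ler_pM2l // prod_le.
have energy := card_translates_energy w S.
have {}energy : g ^+ n ^+ (2 * k) * q ^+ n <= q ^+ n ^+ k * \sum_a \prod_j r a j.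
  have -> : \sum_a \prod_j r a j = (\sum_a \prod_j #|translates (S j) (w j *: a)|)%:R.
    by rewrite natr_sum; apply: eq_bigr => a _; rewrite natr_prod.
  move: energy; rewrite -(ler_nat R) !natrM !natrX -/q; apply: le_trans.
  have gn0 : 0 <= g ^+ n by rewrite exprn_ge0 // ltW.
  rewrite ler_pM2r // mulnC exprM natr_prod; apply: lerXn2r; rewrite ?nnegrE ?prodr_ge0 ?exprn_ge0 ?(ltW g0) //.
  by rewrite -[X in _ ^+ X]card_ord -prodr_const ler_prod // => j _; rewrite Sbig gn0.
have sum_le : q ^+ n * \sum_a \prod_j r a j <= (g1 ^+ n + c%:R) * (q ^+ n * q ^+ n ^+ k).
  rewrite big_distrr (bigID (mem Q)) /= addrC mulrDl lerD //.
    apply: le_trans (_ : \sum_(a | a \notin Q) g1 ^+ n * q ^+ n ^+ k <= _).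
      exact: ler_sum.
    rewrite mulrCA -[X in _ <= X * _]cardV mulr_natl -sumr_const [X in _ <= X](bigID (mem Q)) /=.
    rewrite lerDr sumr_ge0 // => a _; rewrite mulr_ge0 ?exprn_ge0 // ltW //.
  apply: (@le_trans _ _ (\sum_(a in Q) q ^+ n * q ^+ n ^+ k)).
    by apply: ler_sum => a _; rewrite ler_pM2l // -qnk prod_le.
  by rewrite sumr_const -[X in X <= _]mulr_natl ler_pM2r ?ler_nat // mulr_gt0 // -exprM.
have : g ^+ n ^+ (2 * k) * q ^+ n <= (g1 ^+ n + c%:R) * (q ^+ n ^+ k * q ^+ n ^+ k).
  have := @ler_wpM2l R (q ^+ n ^+ k) ltac:(by rewrite -exprM ltW) _ _ sum_le.
  set E := \sum_a _ in energy *; set X := g ^+ n ^+ _ in energy *; set Y := q ^+ n ^+ k in energy *.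
  set G := g1 ^+ n + _; have := qk0 n; set Z := q ^+ n in energy * => Z0 h.
  have : Z * (X * Z) <= Z * (G * (Y * Y)).
    apply: le_trans (_ : Z * (Y * E) <= _); first by rewrite ler_pM2l.
    by apply: le_trans (le_trans _ h) _; rewrite le_eqVlt; apply/orP; left; apply/eqP; ring.
  by rewrite ler_pM2l.
move=> bound; have h : (q * g ^+ (2 * k) / q ^+ (2 * k)) ^+ n <= g1 ^+ n + c%:R.
  have q0 : 0 < q by lra.
  rewrite expr_div_n exprMn ler_pdivrMr ?exprn_gt0 // [q ^+ n * _]mulrC exprAC.
  by rewrite [q ^+ _ ^+ n]exprAC [(2 * k)%N]mulnC [q ^+ n ^+ _]exprM expr2 [(k * 2)%N]mulnC.
have := le_trans big h.
have : g1 ^+ n <= gm ^+ n by apply: lerXn2r; rewrite ?nnegrE //; lra.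
have : 1 <= gm ^+ n by rewrite exprn_ege1.
have : 0 <= c%:R :> R by [].
nra.
Qed.

(** Kernel vectors are added one at a time, each with an [a] popular for the sets
    [translates S (y j)]; the bound [g1] is pulled back through one density loss per vector. *)
Lemma popular_kernel_solution (R : realType) (F : finFieldType) (m k : nat) (A : 'M[F]_(m, k))
    (ws : seq 'rV[F]_k) (g1 : R) :
  {in ws, forall w, A *m w^T = 0} -> 0 < g1 < #|F|%:R ->
  exists2 g : R, 0 < g < #|F|%:R & exists N, forall n (S : {set 'rV[F]_n}), (N <= n)%N ->
    g ^+ n <= #|S|%:R -> exists y : 'I_k -> 'rV[F]_n,
      [/\ is_solution A y, {in ws, forall w : 'rV[F]_k, forall j, w 0 j != 0 -> y j != 0},
          forall j, {in ws, forall w : 'rV[F]_k, w 0 j = 0} -> y j = 0 &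
          forall j, g1 ^+ n <= #|translates S (y j)|%:R].
Proof.
elim: ws g1 => [|w ws IH] g1 ker g1q.
  exists g1 => //; exists 0%N => n S _ gS; exists (fun _ => 0); split=> // [i|j].
    by rewrite big1 // => j _; rewrite scaler0.
  apply: le_trans gS _; rewrite ler_nat; apply: subset_leq_card.
  by apply/subsetP => x xS; rewrite inE addr0 xS.
have [g2 g2q [N2 pop]] := popular_difference k k g1q.
have [|g gq [N1 IHg]] := IH g2 _ g2q; first by move=> v vs; rewrite ker // inE vs orbT.
exists g => //; exists (maxn N1 N2) => n S; rewrite geq_max => /andP[n1 n2] gS.
have [y [soly supp zero many]] := IHg n S n1 gS.
(* The values of [a] at which a coordinate with [w 0 j != 0] would vanish. *)
pose Q := [set - ((w 0 j)^-1 *: y j) | j : 'I_k].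
have Qk : (#|Q| <= k)%N by rewrite (leq_trans (leq_imset_card _ _)) // card_ord.
have [a aQ popa] := pop n (w 0) (fun j => translates S (y j)) Q n2 many Qk.
exists (fun j => y j + w 0 j *: a); split.
- move=> i; under eq_bigr => j _ do rewrite scalerDr scalerA.
  rewrite big_split /= (soly i) add0r -scaler_suml.
  have /matrixP/(_ i 0) := ker w (mem_head _ _); rewrite !mxE => wi.
  rewrite (_ : \sum_j A i j * w 0 j = 0) ?scale0r // -[RHS]wi.
  by apply: eq_bigr => j _; rewrite mxE.
- have notQ j : w 0 j != 0 -> y j + w 0 j *: a != 0.
    move=> wj; apply: contraNneq aQ => h; apply/imsetP; exists j => //.
    have -> : y j = - (w 0 j *: a) by apply/eqP; rewrite -addr_eq0 h.
    by rewrite scalerN opprK scalerA mulVf // scale1r.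
  move=> v; rewrite inE => /orP[/eqP-> //|vs] j vj.
  have [wj|/notQ //] := eqVneq (w 0 j) 0.
  by rewrite wj scale0r addr0 (supp v).
- move=> j h; rewrite h ?mem_head // scale0r addr0 zero // => v vs.
  by rewrite h // inE vs orbT.
(* If [x] and [x + w 0 j *: a] lie in [translates S (y j)], then [x] and [x + (y j + w 0 j *: a)]
   lie in [S]. *)
move=> j; apply: le_trans (popa j) _; rewrite ler_nat; apply: subset_leq_card.
apply/subsetP => x; rewrite !inE => /andP[/andP[xS _] /andP[_]].
by rewrite xS addrAC addrA.
Qed.

(** * Class representatives and starting solutions *)

Section Representatives.
Variables (F : finFieldType) (m k : nat) (A : 'M[F]_(m, k)).
Implicit Types (i j l : 'I_k).

(** The choice depends on the class alone: the default never occurs, since the class contains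
    [j]. *)
Definition rep j := odflt j [pick i in col_class A j].

Lemma mem_rep j : rep j \in col_class A j.
Proof. by rewrite /rep; case: pickP => [i //|/(_ j)]; rewrite col_class_refl. Qed.

Lemma rep_eq i l : l \in col_class A i -> rep l = rep i.
Proof.
move=> lC; rewrite /rep (col_class_eq lC).
by case: pickP => // /(_ i); rewrite col_class_refl.
Qed.

Lemma rep_idem j : rep (rep j) = rep j.
Proof. exact/rep_eq/mem_rep. Qed.

Lemma rep_classP i l : (rep l == rep i) = (l \in col_class A i).
Proof.
apply/eqP/idP => [E|/rep_eq //].
rewrite -(col_class_eq (mem_rep i)) -E (col_class_eq (mem_rep l)) col_class_refl //.
Qed.

(* If no such [w] exists, the coordinate of the class is determined by the
   rows of [A]: some equation involves that class only and splits it off. *)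
Lemma kernel_vector_at_class i : irreducible A -> (#|col_class A i| < k)%N ->
  exists w : 'rV[F]_k, [/\ A *m w^T = 0, forall j, rep j != j -> w 0 j = 0 & w 0 (rep i) != 0].
Proof.
move=> irr small; set r := rep i.
have rr : rep r = r by apply: rep_idem.
(* Only the columns of representatives are kept. If the unit vector at [r] is outside the row space,
   a column of the cokernel gives [w]. *)
pose A' := \matrix_(p < m, j < k) if rep j == j then A p j else 0.
have [sub|] := boolP (delta_mx (0 : 'I_1) r <= A')%MS; last first.
  rewrite submxE -rowE => h.
  have {h} [K [c [AK hc]]] : exists (K : 'M[F]_k) c, A' *m K = 0 /\ K r c != 0.
    have /existsP[c hc] : [exists c, cokermx A' r c != 0].
      rewrite -negb_forall; apply: contra h => /forallP h'.
      by apply/eqP/rowP => c; rewrite mxE [RHS]mxE; apply/eqP.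
    by exists (cokermx A'), c; rewrite mulmx_coker.
  exists (\row_j if rep j == j then K j c else 0); split.
  - apply/matrixP => p z; rewrite !mxE.
    have /matrixP/(_ p c) := AK; rewrite !mxE => E; rewrite -[RHS]E.
    by apply: eq_bigr => j _; rewrite !mxE; case: ifP; rewrite ?mulr0 ?mul0r.
  - by move=> j /negPf h'; rewrite mxE h'.
  - by rewrite mxE rr eqxx.
exfalso; apply: irr; have [u uA'] := submxP sub.
pose rho := u *m A.
have rho_rep j : rep j = j -> rho 0 j = (j == r)%:R.
  move=> jj; have /matrixP/(_ 0 j) := uA'; rewrite !mxE eqxx /= => ->.
  by apply: eq_bigr => p _; rewrite !mxE jj eqxx.
have rho_class j : exists2 c, col j A = c *: col (rep j) A & rho 0 j = c * (rep j == r)%:R.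
  have /mem_col_class[c _ E] := mem_rep j; exists c => //.
  rewrite -rho_rep ?rep_idem // !mxE big_distrr; apply: eq_bigr => p _ /=.
  by have /colP/(_ p) := E; rewrite !mxE => ->; rewrite mulrCA.
(* [rho] is a combination of equations supported on the class of [i]; subtracting its multiples
   clears that class from all rows. *)
pose B := A - col r A *m rho.
exists (1 + m)%N, (col_mx rho B); split.
  apply/andP; split.
    have -> : A = row_mx (col r A) 1%:M *m col_mx rho B.
      by rewrite mul_row_col mul1mx addrC subrK.
    exact: submxMl.
  rewrite col_mx_sub submxMl /= addmx_sub ?submx_refl // eqmx_opp.
  by apply: submx_trans (submxMl _ _) (submxMl _ _).
set C := col_class A i.
have memC j : (rep j == r) = (j \in C) by apply: rep_classP.
have C0 : C != set0 by apply/set0Pn; exists i; apply: col_class_refl.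
have CC0 : ~: C != set0.
  by rewrite -card_gt0 cardsCs setCK card_ord subn_gt0.
have neC : C != ~: C.
  by apply/eqP => /setP/(_ i); rewrite in_setC col_class_refl.
exists [set C; ~: C]; split; first last.
  split; first by rewrite cards2 neC.
  move=> p; case: (split_ordP p) => {}p ->.
    exists C; first by rewrite !inE eqxx.
    move=> j; rewrite col_mxEu (ord1 p) -memC; have [c _ ->] := rho_class j.
    by case: (_ == r) => //; rewrite mulr0 eqxx.
  exists (~: C); first by rewrite !inE eqxx orbT.
  move=> j; rewrite col_mxEd inE -memC; apply: contraNN => /eqP jr.
  have [c E rj] := rho_class j; rewrite !mxE big_ord1 mxE rj jr eqxx mulr1.
  by have /colP/(_ p) := E; rewrite !mxE jr => ->; rewrite mulrC subrr.
apply/and3P; split.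
- by rewrite /cover big_setU1 ?in_set1 // big_set1 /= setUCr.
- apply/trivIsetP => X Y; rewrite !inE => /orP[]/eqP-> /orP[]/eqP->; rewrite ?eqxx // => _.
    by rewrite -setI_eq0 setICr.
  by rewrite -setI_eq0 setIC setICr.
- by rewrite in_set2 negb_or ![set0 == _]eq_sym C0 CC0.
Qed.

(** Take [x j = u (rep j) + y j]: the part from [u] cancels within each class, and in a class of
    size two the values differ by [y] at the representative. *)
Lemma separated_solution n (S : {set 'rV[F]_n}) (y : 'I_k -> 'rV[F]_n) :
  (forall C, C \in col_classes A -> class_sums_to_zero A C) ->
  is_solution A y -> (forall j, rep j != j -> y j = 0) ->
  (forall j, #|col_class A j| = 2%N -> y (rep j) != 0) ->
  (forall j, translates S (y j) != set0) ->
  exists x, [/\ is_solution A x, separated A x & forall j, x j \in S].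
Proof.
move=> sum0 soly y0 y2 tr.
have /fin_all_exists[u uP] j : exists u, (u \in S) && (u + y j \in S).
  by have /set0Pn[u] := tr j; rewrite inE; exists u.
exists (fun j => u (rep j) + y j); split.
- move=> p; under eq_bigr => j _ do rewrite scalerDr.
  rewrite big_split /= (soly p) addr0 (partition_big rep xpredT) //= big1 // => r _.
  rewrite (eq_bigr (fun j => A p j *: u r)) => [|j /eqP -> //].
  rewrite -scaler_suml; have [rr|rr] := eqVneq (rep r) r; last first.
    by rewrite big_pred0 ?scale0r // => j; apply: contraNF rr => /eqP <-; rewrite rep_idem.
  have /eqP/colP/(_ p) := sum0 _ (col_class_in_classes A r).
  rewrite summxE mxE => E; rewrite [X in X *: _](_ : _ = 0) ?scale0r // -[RHS]E.
  by apply: eq_big => [j|j _]; rewrite ?mxE // -rep_classP rr.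
- move=> i l il c2 lC _; rewrite (rep_eq lC).
  have yi := y2 i c2.
  have : rep i \in [set i; l].
    suff <- : col_class A i = [set i; l] by apply: mem_rep.
    apply/esym/eqP; rewrite eqEcard subUset !sub1set col_class_refl lC /=.
    by rewrite c2 cards2 il.
  rewrite (inj_eq (addrI _)) !inE => /orP[/eqP ri|/eqP rl].
    by rewrite (y0 l) ?(rep_eq lC) ?ri // -{1}ri.
  by rewrite (y0 i) ?rl 1?eq_sym // -rl.
move=> j; have [jj|jj] := eqVneq (rep j) j; first by have /andP[] := uP j; rewrite jj.
by rewrite y0 // addr0; have /andP[] := uP (rep j).
Qed.
End Representatives.

(** * Conclusion *)

Lemma moderate_of_large (R : realType) (F : finFieldType) (m k : nat) (A : 'M[F]_(m, k)) (g : R) (N : nat) :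
  0 < g < #|F|%:R ->
  (forall n (S : {set 'rV[F]_n}), (N <= n)%N -> g ^+ n <= #|S|%:R ->
    exists x : 'I_k -> 'rV[F]_n, is_shape A x /\ forall j, x j \in S) ->
  moderate A R.
Proof.
move=> /andP[g0 gq] large; set q : R := #|F|%:R in gq.
have qg1 : 1 < q / g by rewrite ltr_pdivlMr // mul1r.
have p0 l : 1 <= (q / g) ^+ l by rewrite exprn_ege1 // ltW.
(* For [n < N] this factor pushes the threshold above [q ^+ n], so no set [S] reaches it. *)
exists (2 * (q / g) ^+ N), g; split=> //; first by have := p0 N; lra.
move=> n S big; have gn : 0 < g ^+ n by rewrite exprn_gt0.
have [Nn|nN] := leqP N n.
  apply: large => //; apply: le_trans big; have := p0 N; nra.
have : #|S|%:R <= q ^+ n by rewrite -natrX ler_nat (leq_trans (max_card _)) // card_mx mul1n.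
have -> : q ^+ n = (q / g) ^+ n * g ^+ n by rewrite -exprMn divfK // gt_eqF.
move=> /(le_trans big); rewrite ler_pM2r // => h.
have : (q / g) ^+ n <= (q / g) ^+ N by apply: ler_weXn2l; [exact: ltW | exact: ltnW].
by have := p0 N; lra.
Qed.

Theorem theoremA (R : realType) (F : finFieldType) (m k : nat) (A : 'M[F]_(m, k)) :
  typeRC A -> non_degenerate A -> irreducible A ->
  ((forall C, C \in col_classes A -> #|C| = 2%N -> ~~ class_sums_to_zero A C)
   \/
   ((forall C, C \in col_classes A -> class_sums_to_zero A C) /\ (3 <= k)%N)) ->
  moderate A R.
Proof.
move=> [bal single] _ irr cases.
have q2 : (2 : R) <= #|F|%:R by rewrite ler_nat finNzRing_gt1.
have [g1 g1q [N1 start]] : exists2 g : R, 0 < g < #|F|%:R & exists N, forall n (T : {set 'rV[F]_n}),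
    (N <= n)%N -> g ^+ n <= #|T|%:R ->
    exists x, [/\ is_solution A x, separated A x & forall j, x j \in T].
  case: cases => [no2|[sum0 k3]].
    (* Rate 1 only asks for a nonempty [T]; by balance a constant solution works. *)
    exists 1; first by lra.
    exists 0%N => n T _; rewrite expr1n ler1n => /card_gt0P[t tT]; exists (fun _ => t); split=> //.
      by move=> i; rewrite -scaler_suml bal scale0r.
    move=> i l il c2 lC opp; exfalso.
    have /negP := no2 _ (col_class_in_classes A i) c2; apply.
    have -> : col_class A i = [set i; l].
      by apply/esym/eqP; rewrite eqEcard subUset !sub1set col_class_refl lC c2 cards2 il.
    by rewrite /class_sums_to_zero big_setU1 ?inE // big_set1 /= opp.
  (* All kernel vectors supported on representatives; the resulting [y] then vanishes elsewhere. *)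
  pose ws := enum [set w : 'rV[F]_k | (A *m w^T == 0) && [forall j, (rep A j != j) ==> (w 0 j == 0)]].
  have wsP w : w \in ws -> A *m w^T = 0 /\ forall j, rep A j != j -> w 0 j = 0.
    rewrite mem_enum inE => /andP[/eqP-> /forallP h]; split=> // j jj.
    by apply/eqP; apply: (implyP (h j)).
  have ker : {in ws, forall w, A *m w^T = 0} by move=> w /wsP[].
  have [g gq [N sol]] := @popular_kernel_solution R F m k A ws 1 ker ltac:(lra).
  exists g => //; exists N => n T Nn gT.
  have [y [soly supp zero many]] := sol n T Nn gT.
  apply: (separated_solution sum0 soly).
  - by move=> j jj; apply: zero => w /wsP[_]; apply.
  (* Since [k >= 3], a class of size two is proper, as [kernel_vector_at_class] requires. *)
  - move=> j j2; have [|w [kw w0 wj]] := @kernel_vector_at_class _ _ _ _ j irr; first by rewrite j2.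
    apply: (supp w) => //; rewrite mem_enum inE kw eqxx; apply/forallP => l.
    by apply/implyP => /w0 ->.
  - by move=> j; rewrite -card_gt0 -(ler_nat R); apply: le_trans (many j); rewrite expr1n.
(* A rate above 1 makes [T] eventually larger than [k]. *)
pose g2 := Num.max g1 (3 / 2).
have [g2g1 g232] : g1 <= g2 /\ 3 / 2 <= g2 by split; rewrite le_max lexx ?orbT.
have g2q : 0 < g2 < #|F|%:R by rewrite lt_max gt_max; move: g1q => /andP[-> ->]; lra.
have [g gq [N2 spr]] := spread k single g2q.
have [N3 growth] := @exp_dominates R 1 g2 k.+1%:R ltac:(lra).
apply: (@moderate_of_large R F m k A g (maxn N1 (maxn N2 N3))) => // n S.
rewrite !geq_max => /and3P[n1 n2 n3] gS.
have [T [TS g2T shape]] := spr n S n2 gS.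
have [|x [solx sepx xT]] := start n T n1.
  by apply: le_trans g2T; apply: lerXn2r; rewrite ?nnegrE //; move: g1q g2q; lra.
apply: (shape _ x) => //; last by rewrite leq_addl.
by rewrite -(ler_nat R); apply: le_trans g2T; have := growth n n3; rewrite expr1n mulr1.
Qed.
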